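(* For every graph $H$ (with $m_2(H)>0$) there is a constant $c>0$ such that for every integer $n\ge 2$ and every positive integer $q$, Client wins $CW(K_n,H,q)$ whenever $q\leq c\,\dfrac{n^{1/m_2(H)}}{\ln n}$.
   Context: Client-Waiter game on a board $X$ with bias $q$ (a positive integer): two players, Client and Waiter, play in turns. In each turn Waiter offers Client a set of at least $1$ and at most $q+1$ unclaimed elements of $X$; Client claims exactly one of the offered elements and Waiter claims all the other offered elements. The game ends when all elements of $X$ have been claimed. For graphs $G,H$, $CW(G,H,q)$ is the Client-Waiter game on the board $E(G)$ with bias $q$ in which Client wins if at the end of the game the graph formed by the edges he claimed contains a copy of $H$ (as a not necessarily induced subgraph), and otherwise Waiter wins. ''Client wins'' means Client has a winning strategy. For a graph $G$ with $v_G$ vertices and $e_G$ edges, the 2-density is $d_2(G)=\frac{e_G-1}{v_G-2}$ if $v_G\ge 3$ and $d_2(G)=0$ if $v_G\leq 2$; the maximum 2-density is $m_2(G)=\max_{G'\subseteq G} d_2(G')$. *)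

(* Defs.v *)
From mathcomp Require Import all_boot all_order all_algebra.

Set Implicit Arguments.
Unset Strict Implicit.
Unset Printing Implicit Defensive.

Import Order.TTheory GRing.Theory Num.Theory.

Record graph := Graph {
  vertex : finType;
  edges : {set {set vertex}};
  card_edge : forall e, e \in edges -> #|e| = 2
}.

Lemma card_complete_edge n :
  forall e, e \in [set e : {set 'I_n} | #|e| == 2] -> #|e| = 2.
Proof. by move=> e; rewrite inE => /eqP. Qed.

Definition complete_graph n : graph := Graph (@card_complete_edge n).

Section Density.

Local Open Scope ring_scope.

Definition d2 (v e : nat) : rat :=
  if (3 <= v)%N then (e%:R - 1) / (v%:R - 2) else 0.

Definition is_subgraph (G : graph)
    (S : {set vertex G} * {set {set vertex G}}) : bool :=
  (S.2 \subset edges G) && [forall e in S.2, e \subset S.1].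

(* The default value 0 does not change the maximum: the subgraph without
   vertices has 2-density 0. *)
Definition m2 (G : graph) : rat :=
  \big[Num.max/0]_(S : {set vertex G} * {set {set vertex G}}
                   | is_subgraph S) d2 #|S.1| #|S.2|.

End Density.

(* The graph with vertex set T and edge set E contains a copy of H. *)
Definition contains_copy (T : finType) (E : {set {set T}}) (H : graph) : Prop :=
  exists2 f : vertex H -> T, injective f &
    forall e, e \in edges H -> f @: e \in E.

Section ClientWaiter.

Variables (T : finType) (X : {set T}) (q : nat).

(* The rounds played so far, oldest first: each is the set that Waiter offered
   together with the element of it that Client claimed. *)
Definition history := seq ({set T} * T).

Definition unclaimed (h : history) : {set T} := X :\: \bigcup_(r <- h) r.1.

Definition client_set (h : history) : {set T} := [set x in [seq r.2 | r <- h]].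

Definition legal_offer (h : history) (A : {set T}) : bool :=
  (A \subset unclaimed h) && (1 <= #|A| <= q + 1).

Definition client_strategy := history -> {set T} -> T.

(* The histories that can arise when Client follows s, Waiter being free to
   make any legal offer in each round. *)
Inductive play (s : client_strategy) : history -> Prop :=
| play_start : play s [::]
| play_round h A :
    play s h -> legal_offer h A -> play s (rcons h (A, s h A)).

Definition winning_strategy (win : {set T} -> Prop) (s : client_strategy) :=
  (forall h A, play s h -> legal_offer h A -> s h A \in A) /\
  (forall h, play s h -> unclaimed h = set0 -> win (client_set h)).

Definition client_has_winning_strategy (win : {set T} -> Prop) : Prop :=
  exists s : client_strategy, winning_strategy win s.

End ClientWaiter.

Definition client_wins_CW (G H : graph) (q : nat) : Prop :=
  client_has_winning_strategy (edges G) q (fun E => contains_copy E H).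

(* Main.v *)
Require Import Defs.
From mathcomp Require Import all_boot all_order all_algebra.
From mathcomp Require Import zify ring lra.
From mathcomp Require Import boolp sequences.
From mathcomp Require Import reals exp.

Set Implicit Arguments.
Unset Strict Implicit.
Unset Printing Implicit Defensive.

Import Order.TTheory GRing.Theory Num.Theory.
Local Open Scope ring_scope.

(** By the hypergraph container method, the H-free graphs on n vertices are
    covered by exp(O(n^(2 - 1/m_2(H)) ln n)) containers, each of which misses a
    positive proportion of the edges of K_n. A Client who claims an edge of the
    complement of every container therefore builds a copy of H. The complements
    have size at least delta n^2, and Client can meet all the sets of a family
    as soon as the sum over its members D of (q/(q+1))^#|D| is less than 1: this
    sum bounds the expected number of members he misses when he picks uniformly
    at random in each offer, and conditional expectations derandomize this. *)

(** A multihypergraph is given by a set X of edge names and the vertex sets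
    f j of the edges j in X, so that shrinking edges keeps multiplicities. *)
Definition deg (V J : finType) (X : {set J}) (f : J -> {set V}) (S : {set V}) :=
  #|[set j in X | S \subset f j]|.

(** * Containers *)

Section ContainerStep.

Variables (R : realFieldType) (V J : finType) (f : J -> {set V}) (X : {set J}).
Variables (M p A : R).

(** In a state (F, g), the edge names in F have been absorbed: g j is f j minus
    the chosen vertex that absorbed j. An independent set containing the chosen
    vertices is independent in the lower-uniformity hypergraph (F, g). Freezing
    the edges above a saturated set keeps the degrees of (F, g) bounded. *)
Definition saturated (st : {set J} * (J -> {set V})) (S : {set V}) :=
  (S != set0) && (M * p ^+ #|S| * A <= (deg st.1 st.2 S)%:R).

Definition live (st : {set J} * (J -> {set V})) :=
  [set j in X | (j \notin st.1) &&
                [forall S : {set V}, saturated st S ==> ~~ (S \subset f j)]].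

Definition link (st : {set J} * (J -> {set V})) (v : V) :=
  [set j in live st | v \in f j].

Definition absorb (st : {set J} * (J -> {set V})) (v : V) :=
  (st.1 :|: link st v,
   fun j => if j \in link st v then f j :\ v else st.2 j).

Definition absorb_seq (s : seq V) := foldl absorb (set0, f) s.

Lemma absorb_seq_rcons s v : absorb_seq (rcons s v) = absorb (absorb_seq s) v.
Proof. by rewrite /absorb_seq foldl_rcons. Qed.

Lemma link_disjoint (st : {set J} * (J -> {set V})) v : [disjoint st.1 & link st v].
Proof.
rewrite disjoint_sym disjoint_subset; apply/subsetP => j.
by rewrite !inE => /andP[/and3P[]].
Qed.

Lemma card_absorb st v : #|(absorb st v).1| = (#|st.1| + #|link st v|)%N.
Proof.
by rewrite /= cardsU; have := link_disjoint st v; rewrite -setI_eq0 => /eqP->;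
  rewrite cards0 subn0.
Qed.

Lemma absorbed_sub s : (absorb_seq s).1 \subset X.
Proof.
elim/last_ind: s => [|s v IH]; first exact: sub0set.
rewrite absorb_seq_rcons /= subUset IH; apply/subsetP => j.
by rewrite !inE => /andP[/andP[]].
Qed.

(** An edge is absorbed at most once, since live edges lie outside [st.1]; it then loses exactly one
    vertex, a member of [s]. So a set containing both [s] and the shrunken edge contains [f j]. *)
Lemma absorbed_edge s l j : (forall i, i \in X -> #|f i| = l.+1) ->
  j \in (absorb_seq s).1 ->
  #|(absorb_seq s).2 j| = l /\
  f j \subset (absorb_seq s).2 j :|: [set v in s].
Proof.
move=> fl; elim/last_ind: s => [|s v IH]; first by rewrite inE.
rewrite absorb_seq_rcons /=; case: ifP => jL.
  move=> _; move: jL; rewrite !inE => /andP[/andP[jX _] vfj].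
  split; first by have := fl j jX; rewrite (cardsD1 v) vfj => -[].
  apply/subsetP => x xf; rewrite !inE xf mem_rcons inE.
  by case: (x == v).
rewrite inE jL orbF => /IH[-> sub]; split=> //.
apply: (subset_trans sub); apply: setUS; apply/subsetP => x.
by rewrite !inE mem_rcons inE => ->; rewrite orbT.
Qed.

(** A step adds edges above [S] only while [S] is unsaturated, because live edges contain no
    saturated set; the degree before it is then below [M * p ^+ #|S| * A]. The new edges all contain
    [v |: S], so [degX] allows at most [K * p ^+ #|S| * A] of them. *)
Lemma deg_absorbed (K : R) s S : 0 <= K -> 0 <= M -> 0 <= p -> 0 <= A ->
  (forall S : {set V}, S != set0 ->
     (deg X f S)%:R <= K * p ^+ #|S|.-1 * A) ->
  S != set0 ->
  (deg (absorb_seq s).1 (absorb_seq s).2 S)%:R <= (M + K) * p ^+ #|S| * A.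
Proof.
move=> K0 M0 p0 A0 degX S0.
have pA : 0 <= p ^+ #|S| * A by rewrite mulr_ge0 // exprn_ge0.
elim/last_ind: s => [|s v IH].
  rewrite /deg (_ : [set _ in _ | _] = set0); last by apply/setP => j; rewrite !inE.
  by rewrite cards0 -mulrA mulr_ge0 // addr_ge0.
rewrite absorb_seq_rcons; set st := absorb_seq s in IH *.
pose N := [set j in link st v | S \subset f j :\ v].
have leN : (deg (absorb st v).1 (absorb st v).2 S <= deg st.1 st.2 S + #|N|)%N.
  rewrite /deg -[X in (_ <= X + _)%N]/(#|_|); apply: leq_trans (leq_card_setU _ _).
  apply: subset_leq_card; apply/subsetP => j; rewrite in_set in_setU [absorb]lock.
  rewrite -lock /= in_setU => /andP[]; have [jL _ jS|jL] := boolP (j \in link st v).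
    by apply/orP; right; rewrite /N in_set jL.
  by rewrite orbF => jF jS; apply/orP; left; rewrite in_set jF.
have [N0|[j]] := set_0Vmem N.
  apply: le_trans IH; rewrite ler_nat; apply: leq_trans leN _.
  by rewrite N0 cards0 addn0.
rewrite !inE => /andP[/andP[/andP[_ /andP[_ /forallP/(_ S) nsat]] _] subS]; move: nsat.
have vS : v \notin S by apply/negP => /(subsetP subS); rewrite !inE eqxx.
rewrite (subset_trans subS (subsetDl _ _)) implybF negb_and S0 /= -ltNge => ltM.
apply: (@le_trans _ _ ((deg st.1 st.2 S)%:R + #|N|%:R)).
  by rewrite -natrD ler_nat.
rewrite mulrDl mulrDl lerD ?(ltW ltM) //.
have vS0 : v |: S != set0 by apply/set0Pn; exists v; rewrite !inE eqxx.
have := degX _ vS0; rewrite cardsU1 vS add1n /= => le2; apply: le_trans le2.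
rewrite ler_nat; apply: subset_leq_card; apply/subsetP => i; rewrite !inE.
move=> /andP[/andP[/andP[-> _] vi] Si] /=; apply/subsetP => x.
by rewrite !inE => /orP[/eqP->|/(subsetP Si)]; rewrite ?inE // => /andP[].
Qed.

(** Greedy choice: as long as some vertex of [I] has a link of size at least [tau], absorbing it
    adds that many new edges. *)
Lemma exists_absorb_seq (tau : R) (I : {set V}) k :
  exists s : seq V, [/\ (size s <= k)%N, {subset s <= I} &
    tau * k%:R <= #|(absorb_seq s).1|%:R \/
    forall v, v \in I -> #|link (absorb_seq s) v|%:R < tau].
Proof.
elim: k => [|k [s [sk sI [ls|]]]].
- by exists [::]; split=> //; left; rewrite mulr0 ler0n.
- have [[v vI ltv]|nv] := pselect (exists2 v, v \in I &
    tau <= #|link (absorb_seq s) v|%:R).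
    exists (rcons s v); split; first by rewrite size_rcons.
      by move=> x; rewrite mem_rcons inE => /orP[/eqP->|/sI].
    by left; rewrite absorb_seq_rcons card_absorb natrD -[k.+1]addn1 natrD mulrDr mulr1 lerD.
  exists s; split=> //; [exact: leqW|right=> v vI].
  by rewrite ltNge; apply/negP => le; apply: nv; exists v.
- by move=> lt; exists s; split=> //; [exact: leqW|right].
Qed.

Lemma sum_card_deg (B : {set J}) (g : J -> {set V}) l :
  (forall j, j \in B -> #|g j| = l) ->
  (\sum_(v : V) #|[set j in B | v \in g j]| = l * #|B|)%N.
Proof.
move=> gl; transitivity (\sum_(v : V) \sum_(j in B) (v \in g j))%N.
  apply: eq_bigr => v _; rewrite -sum1_card big_mkcond [RHS]big_mkcond /=.
  by apply: eq_bigr => j _; rewrite !inE; case: (j \in B); case: (v \in g j).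
rewrite exchange_big /= (eq_bigr (fun=> l)); first by rewrite sum_nat_const mulnC.
move=> j jB; rewrite -(gl j jB) -sum1_card big_mkcond /= [RHS]big_mkcond /=.
by apply: eq_bigr => v _; case: (v \in g j).
Qed.

Lemma sum_deg (B : {set J}) (g : J -> {set V}) l :
  (forall j, j \in B -> #|g j| = l) ->
  (\sum_(S : {set V}) deg B g S = 2 ^ l * #|B|)%N.
Proof.
move=> gl; transitivity (\sum_(S : {set V}) \sum_(j in B) (S \subset g j))%N.
  apply: eq_bigr => v _; rewrite /deg -sum1_card big_mkcond [RHS]big_mkcond /=.
  by apply: eq_bigr => j _; rewrite !inE; case: (j \in B); case: (v \subset g j).
rewrite exchange_big /= (eq_bigr (fun=> (2 ^ l)%N)).
  by rewrite sum_nat_const mulnC.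
move=> j jB; rewrite -(gl j jB) -card_powerset -sum1_card big_mkcond /= [RHS]big_mkcond /=.
by apply: eq_bigr => v _; rewrite inE; case: (v \subset g j).
Qed.

(** By [degX] and the choice of [M], a saturated [S] satisfies [2 ^+ l * p * deg X f S <= deg st.1
    st.2 S]. Summing over [S] counts each absorbed edge once per subset, hence [2 ^ l] times, and
    this factor cancels. *)
Lemma card_killed (K : R) l s : 0 < K -> 0 < p -> 0 < A -> M = K * 2 ^+ l ->
  (forall j, j \in X -> #|f j| = l.+1) ->
  (forall S : {set V}, S != set0 ->
     (deg X f S)%:R <= K * p ^+ #|S|.-1 * A) ->
  p * #|[set j in X | [exists S : {set V},
           saturated (absorb_seq s) S && (S \subset f j)]]|%:R
    <= #|(absorb_seq s).1|%:R.
Proof.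
move=> K0 p0 A0 defM fl degX; set st := absorb_seq s; set Z := [set j in X | _].
have leZ : (#|Z| <= \sum_(S | saturated st S) deg X f S)%N.
  have -> : Z = \bigcup_(S | saturated st S) [set j in X | S \subset f j].
    apply/setP => j; rewrite !inE; apply/andP/bigcupP.
      by case=> jX /existsP[S /andP[sS Sf]]; exists S; rewrite // inE jX.
    by case=> S sS; rewrite inE => /andP[-> Sf]; split=> //;
        apply/existsP; exists S; rewrite sS.
  elim/big_rec2: _ => [|S B n _ le]; first by rewrite cards0.
  by apply: leq_trans (leq_card_setU _ _) _; rewrite leq_add2l.
have uF j : j \in st.1 -> #|st.2 j| = l by move=> /(absorbed_edge fl)[].
have two0 : (0 : R) < 2 ^+ l by rewrite exprn_gt0.
rewrite -(ler_pM2l two0) -[X in _ <= X](_ : (2 ^ l * #|st.1|)%:R = _);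
  last by rewrite natrM natrX.
rewrite -(sum_deg uF) natr_sum mulrA.
apply: (@le_trans _ _ (\sum_(S | saturated st S) (2 ^+ l * p) * (deg X f S)%:R)).
  by rewrite -mulr_sumr -natr_sum ler_pM2l ?mulr_gt0 // ler_nat.
rewrite [X in _ <= X](bigID (saturated st)) /= -[X in X <= _]addr0 lerD ?sumr_ge0 //.
apply: ler_sum => S /andP[S0]; apply: le_trans.
have := degX S S0; rewrite -(ler_pM2l (mulr_gt0 two0 p0)) => le; apply: (le_trans le).
rewrite defM -(prednK (_ : 0 < #|S|)%N) ?card_gt0 // exprS.
by rewrite le_eqVlt; apply/orP; left; apply/eqP; ring.
Qed.

End ContainerStep.

Lemma leq_card_bigcup (I T : finType) (P : pred I) (F : I -> {set T}) m :
  (forall i, P i -> #|F i| <= m)%N -> (#|\bigcup_(i | P i) F i| <= #|P| * m)%N.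
Proof.
move=> Fm; rewrite -sum_nat_const.
elim/big_rec2: _ => [|i B n Pi le]; first by rewrite cards0.
by apply: leq_trans (leq_card_setU _ _) _; rewrite leq_add // Fm.
Qed.

(** Padding with [None] encodes the sequences of at most [b] vertices by tuples of one fixed length,
    which are easy to count. *)
Lemma pmap_id_pad (T : Type) (s : seq T) b : (size s <= b)%N ->
  exists t : b.-tuple (option T), pmap id t = s.
Proof.
move=> sb; have sz : size (map some s ++ nseq (b - size s) None) == b.
  by rewrite size_cat size_map size_nseq subnKC.
exists (Tuple sz); rewrite /= pmap_cat.
have -> : pmap id (nseq (b - size s) (@None T)) = [::] by elim: (b - _)%N.
by rewrite cats0; elim: (s) => //= x r ->.
Qed.

(** C consists of the complements of the containers. A member of C is encoded by
    at most b vertices at each of the l levels. At a level, either the independent set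
    always provides a vertex with a large link, and the absorbed hypergraph is
    dense enough to recurse, or all its vertices end up with small links, and
    the vertices with a large link form the set D. *)
Lemma containers (R : realFieldType) (l : nat) (c K : R) : 0 < c -> 0 < K ->
  exists2 delta : R, 0 < delta &
    forall (V J : finType) (f : J -> {set V}) (X : {set J}) (p A : R) (b : nat),
    0 < p -> p <= 1 -> 0 < A -> p * #|V|%:R <= b%:R -> (0 < #|V|)%N ->
    c * A * #|V|%:R <= #|X|%:R ->
    (forall j, j \in X -> #|f j| = l) ->
    (forall S : {set V}, S != set0 ->
       (deg X f S)%:R <= K * p ^+ #|S|.-1 * A) ->
    exists C : {set {set V}},
      [/\ (#|C| <= #|V|.+1 ^ (l * b))%N,
          forall D, D \in C -> delta * #|V|%:R <= #|D|%:R &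
          forall I : {set V}, (forall j, j \in X -> ~~ (f j \subset I)) ->
            exists2 D, D \in C & [disjoint D & I]].
Proof.
elim: l c K => [|l IH] c K c0 K0.
  (* Edges of size 0 lie in every set and [X] is nonempty, so no set is independent and the empty
     family suffices. *)
  exists 1 => // V J f X p A b p0 p1 A0 pb V0 cX f0 _; exists set0.
  split=> [|D|I indep]; rewrite ?cards0 ?inE //.
  have : (0 : R) < #|X|%:R by apply: lt_le_trans cX; rewrite !mulr_gt0 ?ltr0n.
  rewrite ltr0n card_gt0 => /set0Pn[j jX].
  by have := indep j jX; rewrite (cards0_eq (f0 j jX)) sub0set.
(* Of at least 4Y edges, with Y = [c / 4 * A * #|V|], fewer than Y are absorbed and fewer than Y lie
   above saturated sets in the sparse case; small links account for at most Y, which leaves Y for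
   [D]. *)
have c40 : 0 < c / 4 by rewrite divr_gt0.
set M := K * 2 ^+ l; have M0 : 0 < M by rewrite mulr_gt0 // exprn_gt0.
have MK0 : 0 < M + K by rewrite addr_gt0.
have [delta delta0 IHd] := IH (c / 4) (M + K) c40 MK0.
exists (Num.min delta (c / 4 / K)); first by rewrite lt_min delta0 divr_gt0.
move=> V J f X p A b p0 p1 A0 pb V0 cX fl degX.
have N0 : (0 : R) < #|V|%:R by rewrite ltr0n.
pose tau := c / 4 * A.
have tau0 : 0 < tau by rewrite mulr_gt0.
pose st := absorb_seq f X M p A.
pose good s (I : {set V}) := {subset s <= I} /\
  (tau * b%:R <= #|(st s).1|%:R \/
   forall v, v \in I -> #|link f X M p A (st s) v|%:R < tau).
have step s : exists C : {set {set V}},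
      [/\ (#|C| <= #|V|.+1 ^ (l * b))%N,
          forall D, D \in C -> Num.min delta (c / 4 / K) * #|V|%:R <= #|D|%:R &
          forall I : {set V}, (forall j, j \in X -> ~~ (f j \subset I)) ->
            good s I -> exists2 D, D \in C & [disjoint D & I]].
  (* The degree bound [(M + K) * p ^+ #|S| * A] is the hypothesis one level down with [p * A] in
     place of [A]. *)
  have [many|few] := leP (c / 4 * (p * A) * #|V|%:R) #|(st s).1|%:R.
    have [j jF|S S0|C [Cb CD CI]] :=
      IHd V J (st s).2 (st s).1 p (p * A) b p0 p1 (mulr_gt0 p0 A0) pb V0 many.
    - by have [] := absorbed_edge fl jF.
    - have := deg_absorbed s (ltW K0) (ltW M0) (ltW p0) (ltW A0) degX S0.
      rewrite -[X in _ ^+ X](prednK (_ : 0 < #|S|)%N) ?card_gt0 // exprSr.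
      by rewrite -!mulrA.
    exists C; split=> // [D /CD|I indep [sI _]].
      by apply: le_trans; rewrite ler_pM2r // ge_min lexx.
    apply: CI => j jF; apply/negP => gI.
    have [_ fsub] := absorbed_edge fl jF.
    have /negP := indep j (subsetP (absorbed_sub _ _ _ _ _ _) _ jF); apply.
    apply: subset_trans fsub _; rewrite subUset gI /=.
    by apply/subsetP => x; rewrite inE => /sI.
  pose D := [set v | tau <= #|link f X M p A (st s) v|%:R].
  exists [set D]; split=> [|D'|I indep [sI [big|small]]].
  - by rewrite cards1 expn_gt0.
  - rewrite inE => /eqP->{D'}.
    have kill := card_killed s K0 p0 A0 (erefl M) fl degX.
    set Z := [set j in X | _] in kill; rewrite -/(st s) in kill.
    have XZ : (#|X| <= #|live f X M p A (st s)| + (#|(st s).1| + #|Z|))%N.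
      apply: (@leq_trans #|live f X M p A (st s) :|: ((st s).1 :|: Z)|).
        apply: subset_leq_card; apply/subsetP => j jX; rewrite !inE jX /=.
        case: (j \in (st s).1) => //=; rewrite ?orbT //.
        rewrite -implyNb; apply/implyP.
        rewrite negb_forall /= => /existsP[S]; rewrite negb_imply negbK => sS.
        by apply/existsP; exists S.
      apply: leq_trans (leq_card_setU _ _) _; rewrite leq_add2l.
      exact: leq_card_setU.
    (* Live edges are counted through their vertices: a vertex of [D] has at most [K * A] of them,
       any other fewer than [tau]. *)
    have sumD : (#|live f X M p A (st s)|%:R : R) <=
        #|D|%:R * (K * A) + #|V|%:R * tau.
      apply: (@le_trans _ _ (\sum_v #|link f X M p A (st s) v|%:R)).
        rewrite -natr_sum ler_nat (sum_card_deg (l := l.+1)) ?leq_pmull // => j.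
        by rewrite inE => /andP[/fl].
      rewrite (bigID (mem D)) /=; apply: lerD.
        apply: (@le_trans _ _ (\sum_(v in D) K * A)); last by rewrite sumr_const mulr_natl.
        apply: ler_sum => v _.
        have /degX : [set v] != set0 by apply/set0Pn; exists v; rewrite inE.
        rewrite cards1 expr0 mulr1; apply: le_trans.
        rewrite ler_nat; apply: subset_leq_card; apply/subsetP => j.
        by rewrite !inE sub1set => /andP[/andP[->]].
      apply: (@le_trans _ _ (\sum_(v | v \notin D) tau)).
        by apply: ler_sum => v; rewrite inE -ltNge => /ltW.
      rewrite sumr_const -[_ *+ _]mulr_natl ler_pM2r // ler_nat.
      exact: max_card.
    set Y := c / 4 * A * #|V|%:R.
    have defY : c / 4 * (p * A) * #|V|%:R = p * Y by rewrite /Y; ring.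
    rewrite defY in few.
    have Y0 : 0 < Y by apply: mulr_gt0 N0; apply: mulr_gt0 c40 A0.
    have Zlt : #|Z|%:R < Y by rewrite -(ltr_pM2l p0); apply: le_lt_trans few.
    have Flt : #|(st s).1|%:R < Y.
      by apply: lt_le_trans few _; rewrite ler_piMl // ltW.
    have X4 : c * A * #|V|%:R = 4 * Y by rewrite /Y; field.
    have NY : #|V|%:R * tau = Y by rewrite /tau /Y mulrC.
    rewrite -(ler_nat R) !natrD in XZ; rewrite X4 in cX; rewrite NY in sumD.
    have YD : Y <= #|D|%:R * (K * A) by lra.
    apply: (@le_trans _ _ (c / 4 / K * #|V|%:R)).
      by rewrite ler_pM2r // ge_min lexx orbT.
    rewrite -(ler_pM2r (mulr_gt0 K0 A0)); apply: le_trans YD.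
    by rewrite le_eqVlt; apply/orP; left; apply/eqP; rewrite /Y; field; rewrite gt_eqF.
  (* As [p * #|V| <= b], absorbing [tau * b] edges would contradict [few]. *)
  - have le1 : c / 4 * (p * A) * #|V|%:R <= tau * b%:R.
      have -> : c / 4 * (p * A) * #|V|%:R = tau * (p * #|V|%:R) by rewrite /tau; ring.
      by rewrite ler_pM2l.
    by have := lt_le_trans few (le_trans le1 big); rewrite ltxx.
  - exists D; first by rewrite inE.
    rewrite disjoint_subset; apply/subsetP => v; rewrite !inE => tv.
    by apply/negP => /small; rewrite ltNge tv.
(* One family per code: the union costs a factor [#|V|.+1 ^ b], which turns the exponent [l * b]
   into [l.+1 * b]. *)
have [C CP] := choice (fun t : b.-tuple (option V) => step (pmap id t)).
exists (\bigcup_t C t); split=> [|D /bigcupP[t _]|I indep].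
- apply: leq_trans (leq_card_bigcup (m := #|V|.+1 ^ (l * b)) _) _.
    by move=> t _; have [] := CP t.
  by rewrite card_tuple card_option mulSn expnD.
- by have [_ CD _] := CP t; apply: CD.
have [s [sb sI sgood]] := exists_absorb_seq f X M p A tau I b.
have [t ts] := pmap_id_pad sb.
have [_ _ /(_ I indep)[|D DC DI]] := CP t; first by rewrite ts.
by exists D => //; apply/bigcupP; exists t.
Qed.

(** * The transversal game *)

Section Transversal.

Variables (R : realFieldType) (T : finType) (x0 : T) (X : {set T}) (q : nat).
Variables (C : {set {set T}}) (q_gt0 : (0 < q)%N).
Hypothesis CX : forall D, D \in C -> D \subset X.

(** The probability that a uniform choice from an offer of full size [q + 1] misses a given offered
    element. *)
Let r : R := q%:R / (q%:R + 1).

(** The expected number of members of C that a Client who plays at random from h on misses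
    is at most danger h. *)
Definition danger (h : history T) : R :=
  \sum_(D in C | [disjoint D & client_set h]) r ^+ #|D :&: unclaimed X h|.

Let q0 : (0 : R) < q%:R. Proof. by rewrite ltr0n. Qed.
Let r0 : 0 < r. Proof. by rewrite divr_gt0 // addr_gt0. Qed.

Let bernoulli k : 1 - k%:R / (q%:R + 1) <= r ^+ k.
Proof.
have q1 : q%:R + 1 != 0 :> R by rewrite gt_eqF // addr_gt0.
elim: k => [|k IH]; first by rewrite mul0r subr0 expr0.
rewrite exprSr; apply: le_trans (_ : (1 - k%:R / (q%:R + 1)) * r <= _); last first.
  by rewrite ler_pM2r.
have -> : (1 - k%:R / (q%:R + 1)) * r = 1 - k.+1%:R / (q%:R + 1) + k%:R / (q%:R + 1) ^+ 2.
  by rewrite /r -natr1; field.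
by rewrite lerDl divr_ge0 // exprn_ge0 // addr_ge0 // ltW.
Qed.

Lemma unclaimed_rcons (h : history T) (A : {set T}) x :
  unclaimed X (rcons h (A, x)) = unclaimed X h :\: A.
Proof. by rewrite /unclaimed -cats1 big_cat big_seq1 /= setDDl. Qed.

Lemma client_set_rcons (h : history T) (A : {set T}) x :
  client_set (rcons h (A, x)) = x |: client_set h.
Proof. by apply/setP => y; rewrite !inE map_rcons mem_rcons inE. Qed.

(** Let k be [#|D :&: A|]. A uniform choice from [A] avoids [D] with probability 1 - k/|A|, at most
    1 - k/(q+1), hence at most [r ^+ k] by Bernoulli. This makes up for the factor [r ^- k] by which
    the term of a missed [D] grows. *)
Lemma danger_average h A : legal_offer X q h A ->
  \sum_(x in A) danger (rcons h (A, x)) <= #|A|%:R * danger h.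
Proof.
case/andP => AU /andP[A0 Aq].
rewrite /danger mulr_sumr.
under eq_bigr => x xA do rewrite big_mkcondr /=.
rewrite exchange_big /= [leRHS]big_mkcondr /=; apply: ler_sum => D DC.
have [dis|ndis] := ifP; last first.
  rewrite big1 // => x xA; rewrite client_set_rcons; case: ifP => // dis.
  by rewrite (disjointWr (subsetUr _ _) dis) in ndis.
set U := unclaimed X h in AU *.
have cardDU : #|D :&: U| = (#|D :&: (U :\: A)| + #|D :&: A|)%N.
  rewrite addnC -(cardsID A (D :&: U)) -!setIA (setIidPr AU); congr (_ + #|_|)%N.
  by rewrite setIDA.
have cardA : #|A| = (#|A :\: D| + #|D :&: A|)%N.
  by rewrite addnC setIC cardsID.
rewrite (eq_bigr (fun x => if x \notin D then r ^+ #|D :&: (U :\: A)| else 0)); last first.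
  move=> x xA; rewrite unclaimed_rcons client_set_rcons.
  suff -> : [disjoint D & x |: client_set h] = (x \notin D) by [].
  apply/idP/idP => [dis'|xD]; first by rewrite (disjointFl dis') // setU11.
  rewrite disjoint_subset; apply/subsetP => y yD.
  rewrite -[y \in _]/(y \notin _) in_setU1 negb_or (disjointFr dis yD) andbT.
  by apply: contraNneq xD => <-.
rewrite -big_mkcondr sumr_const -[_ *+ _]mulr_natl cardDU exprD.
rewrite (_ : #|_| = #|A :\: D|); last by apply: eq_card => x; rewrite !inE andbC.
rewrite [leRHS]mulrCA [leRHS]mulrC ler_pM2r ?exprn_gt0 //.
apply: le_trans (_ : #|A|%:R * (1 - #|D :&: A|%:R / (q%:R + 1)) <= _); last first.
  by rewrite ler_wpM2l.
rewrite mulrBr mulr1 lerBrDr mulrC -mulrA [in leRHS]cardA natrD lerD2l.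
rewrite ler_piMr // mulrC ler_pdivrMr ?addr_gt0 // mul1r.
by rewrite natr1 ler_nat -addn1.
Qed.

(** The default [x0] is returned only if every choice increases the danger, which [danger_average]
    excludes for legal offers. *)
Definition transversal_strategy : client_strategy T := fun h A =>
  if [pick x in A | danger (rcons h (A, x)) <= danger h] is Some x then x else x0.

Lemma transversal_strategyP h A : legal_offer X q h A ->
  transversal_strategy h A \in A /\
  danger (rcons h (A, transversal_strategy h A)) <= danger h.
Proof.
move=> hA; rewrite /transversal_strategy; case: pickP => [x /andP[]//|none].
have /andP[_ /andP[A0 _]] := hA.
have : \sum_(x in A) danger h < \sum_(x in A) danger (rcons h (A, x)).
  apply: ltr_sum => [|x xA]; last by move: (none x); rewrite xA /= ltNge => ->.
  by apply/hasP; have /card_gt0P[x xA] := A0; exists x; rewrite ?mem_index_enum.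
by rewrite sumr_const -mulr_natl ltNge danger_average.
Qed.

(** The danger starts below 1 and never increases. Once nothing is unclaimed, each missed [D]
    contributes [r ^+ 0], which is 1, so none is missed. *)
Lemma client_hits_all : \sum_(D in C) r ^+ #|D| < 1 ->
  client_has_winning_strategy X q
    (fun W : {set T} => forall D, D \in C -> ~~ [disjoint D & W]).
Proof.
move=> small; exists transversal_strategy; split=> [h A _ /transversal_strategyP[]//|].
move=> h hplay; have : danger h < 1.
  elim: hplay => [|h' A _ IH /transversal_strategyP[_ le]]; last exact: le_lt_trans le IH.
  apply: le_lt_trans small; rewrite /danger big_mkcondr /=; apply: ler_sum => D DC.
  case: ifP => _; last by rewrite exprn_ge0 // ltW.
  by rewrite /unclaimed big_nil setD0 (setIidPl (CX DC)).
move=> lt1 U0 D DC; apply/negP => dis; move: lt1.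
rewrite /danger U0 (bigD1 D) ?DC //= setI0 cards0 expr0 ltNge lerDl.
by rewrite sumr_ge0 // => D' _; rewrite exprn_ge0 // ltW.
Qed.

End Transversal.

(** * Copies of H in the complete graph *)

Notation pair_of n := {e : {set 'I_n} | #|e| == 2}.

Lemma card_pair_of n : #|{: pair_of n}| = 'C(n, 2).
Proof.
rewrite card_sig -[n in RHS]card_ord -(cardsT 'I_n) -cards_draws.
by apply: eq_card => A; rewrite !inE subsetT.
Qed.

Lemma card_ffun_into (aT rT : finType) (U : {set aT}) (Q : {set rT}) :
  #|[set j : {ffun aT -> rT} | [forall u in U, j u \in Q]]|
    = (#|Q| ^ #|U| * #|rT| ^ #|~: U|)%N.
Proof.
rewrite (_ : #|_| = #|family (fun u => if u \in U then mem Q else mem [set: rT])|).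
  rewrite card_family foldrE big_map big_enum /= (bigID (mem U)) /=.
  congr (_ * _)%N.
    rewrite -prod_nat_const; apply: eq_bigr => u ->; exact: eq_card.
  rewrite -prod_nat_const; apply: eq_big => [u|u /negPf->]; first by rewrite inE.
  by rewrite -cardsT.
apply: eq_card => j; rewrite inE; apply/forallP/familyP => jP u.
  by have := jP u; case: ifP.
by have := jP u; case: ifP.
Qed.

Section Embeddings.

Variables (H : graph) (n : nat).

(** Embeddings serve as edge names: several of them may have the same [copy], and counting them all
    gives a falling factorial. *)
Definition embeddings := [set j : {ffun vertex H -> 'I_n} | injectiveb j].

Definition copy (j : {ffun vertex H -> 'I_n}) : {set pair_of n} :=
  [set x | val x \in [set j @: e | e : {set vertex H} in edges H]].

Lemma card_embeddings : #|embeddings| = n ^_ #|vertex H|.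
Proof.
rewrite -[n in RHS]card_ord -card_inj_ffuns.
by apply: eq_card => j; rewrite inE.
Qed.

Lemma card_copy j : j \in embeddings -> #|copy j| = #|edges H|.
Proof.
rewrite inE => /injectiveP jinj.
rewrite -(card_imset _ val_inj) -(card_imset (mem (edges H)) (imset_inj jinj)).
apply: eq_card => A; apply/imsetP/imsetP => [[x]|[e eE ->{A}]].
  by rewrite inE => /imsetP[e eE xe] ->; exists e.
have je2 : #|j @: e| == 2 by rewrite card_imset // (card_edge eE).
exists (exist (fun A : {set 'I_n} => #|A| == 2) _ je2) => //.
by rewrite inE; apply/imsetP; exists e.
Qed.

(** Let [P] be the set of edges of [H] that [j] maps into [S]. The vertices covered by [P] must go
    to those covered by [S], at most twice the number of edges of [H]; the other vertices are
    free. *)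
Lemma deg_embeddings (S : {set pair_of n}) :
  (deg embeddings copy S <=
   \sum_(P : {set {set vertex H}} | (P \subset edges H) && (#|P| == #|S|))
     (#|edges H|.*2.+1 ^ #|vertex H| * n ^ (#|vertex H| - #|cover P|)))%N.
Proof.
pose Q := cover (val @: S).
apply: (@leq_trans #|\bigcup_(P : {set {set vertex H}} | (P \subset edges H) && (#|P| == #|S|))
    [set j : {ffun vertex H -> 'I_n} | [forall u in cover P, j u \in Q]]|).
  apply: subset_leq_card; apply/subsetP => j; rewrite inE => /andP[jX Sj].
  have jinj : injective j by move: jX; rewrite inE => /injectiveP.
  pose P := [set e in edges H | j @: e \in val @: S].
  have jP : [set j @: (e : {set vertex H}) | e in P] = val @: S.
    apply/setP => A; apply/imsetP/idP => [[e]|AS]; first by rewrite inE => /andP[_ ?] ->.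
    have /imsetP[x xS defA] := AS.
    have := subsetP Sj x xS; rewrite inE -defA => /imsetP[e eE Ae].
    by exists e => //; rewrite inE eE -Ae.
  apply/bigcupP; exists P.
    apply/andP; split; first by apply/subsetP => e; rewrite inE => /andP[].
    by rewrite -(card_imset (mem P) (imset_inj jinj)) jP (card_imset _ val_inj).
  rewrite inE; apply/forallP => u; apply/implyP => /bigcupP[e].
  rewrite inE => /andP[_ jeS] ue; apply/bigcupP; exists (j @: e) => //.
  exact: imset_f.
elim/big_rec2: _ => [|P m B /andP[PE /eqP PS] le]; first by rewrite cards0.
apply: leq_trans (leq_card_setU _ _) _; apply: leq_add => //.
have -> : (#|vertex H| - #|cover P| = #|~: cover P|)%N.
  by rewrite -(cardsC (cover P)) addKn.
rewrite card_ffun_into card_ord; apply: leq_mul => //.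
have Q2 : (#|Q| <= #|edges H|.*2)%N.
  apply: leq_trans (leq_card_cover _) _.
  rewrite (eq_bigr (fun=> 2)); last by move=> A /imsetP[x _ ->]; apply/eqP/(valP x).
  rewrite sum_nat_const (card_imset _ val_inj) muln2 leq_double -PS.
  exact: subset_leq_card.
(* The successor makes the base positive, so the exponent may be raised to [#|vertex H|]. *)
apply: (@leq_trans (#|edges H|.*2.+1 ^ #|cover P|)).
  by case: #|cover P| => // k; rewrite leq_exp2r // leqW.
by rewrite leq_pexp2l // max_card.
Qed.
End Embeddings.

(** * Consequences of the maximum 2-density *)

Lemma card_cover_ge2 (H : graph) (P : {set {set vertex H}}) :
  P \subset edges H -> P != set0 -> (2 <= #|cover P|)%N.
Proof.
move=> PE /set0Pn[e eP]; rewrite -(card_edge (subsetP PE e eP)).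
exact: subset_leq_card (bigcup_sup e eP).
Qed.

(** Clearing the denominator of [d2] includes the case of a single edge, where both sides are 0. *)
Lemma card_edges_le_m2 (H : graph) (P : {set {set vertex H}}) :
  P \subset edges H -> P != set0 ->
  #|P|%:R - 1 <= m2 H * (#|cover P|%:R - 2).
Proof.
move=> PE P0; have := card_cover_ge2 PE P0; rewrite leq_eqVlt => /orP[/eqP c2|c3].
  have -> : P = [set cover P].
    apply/eqP; rewrite eqEsubset; apply/andP; split.
      apply/subsetP => e eP; rewrite inE eqEcard (bigcup_sup e eP) -c2.
      by rewrite (card_edge (subsetP PE e eP)).
    rewrite sub1set; have /set0Pn[e eP] := P0.
    suff <- : e = cover P by [].
    apply/eqP; rewrite eqEcard (bigcup_sup e eP) -c2.
    by rewrite (card_edge (subsetP PE e eP)).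
  by rewrite cards1 /cover big_set1 -/(cover P) -c2 !subrr mulr0.
rewrite -ler_pdivrMr ?subr_gt0 ?ltr_nat //.
have -> : (#|P|%:R - 1) / (#|cover P|%:R - 2) = d2 #|cover P| #|P| by rewrite /d2 c3.
have subP : is_subgraph (cover P, P).
  rewrite /is_subgraph PE /=; apply/forall_inP => e eP; exact: (bigcup_sup e eP).
have := le_bigmax_cond 0
  (fun S : {set vertex H} * {set {set vertex H}} => d2 #|S.1| #|S.2|) subP.
by rewrite /m2.
Qed.

Lemma m2_gt0_card_edges (H : graph) : 0 < m2 H -> (1 < #|edges H|)%N.
Proof.
move=> m0; rewrite ltnNge; apply/negP => E1.
move: m0; rewrite ltNge => /negP[].
apply: bigmax_le => // -[U F] /andP[/= FE _]; rewrite /d2; case: ifP => // U3.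
rewrite mulr_le0_ge0 ?invr_ge0 ?subr_ge0 ?subr_le0 ?lern1 ?ler_nat ?(ltnW U3) //.
exact: leq_trans (subset_leq_card FE) E1.
Qed.

(** Two edges cover at most four vertices. *)
Lemma m2_ge_half (H : graph) : 0 < m2 H -> 1 / 2 <= m2 H.
Proof.
move=> m0; have := m2_gt0_card_edges m0.
case/card_gt1P => e1 [e2 [e1E e2E e12]].
have PE : [set e1; e2] \subset edges H by rewrite subUset !sub1set e1E.
have P0 : [set e1; e2] != set0 by apply/set0Pn; exists e1; rewrite !inE eqxx.
have c2 : (2 : rat) <= #|cover [set e1; e2]|%:R by rewrite ler_nat card_cover_ge2.
have c4 : #|cover [set e1; e2]|%:R <= (4 : rat).
  rewrite ler_nat -[4%N]/(2 + 2)%N -{1}(card_edge e1E) -(card_edge e2E).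
  by apply: leq_trans (leq_card_cover _) _; rewrite big_setU1 ?inE //= big_set1.
have := card_edges_le_m2 PE P0; rewrite cards2 e12 -[(nat_of_bool _).+1]/2%N => le.
have le2 : m2 H * (#|cover [set e1; e2]|%:R - 2) <= m2 H * 2.
  by rewrite ler_pM2l //; lra.
by move: (le_trans le le2); lra.
Qed.

(** This is the degree hypothesis of [containers] with p = n^(-1/m2) and A = n^(v-2). It holds
    because |P| - 1 is at most m2 (|cover P| - 2), and there are at most [2 ^ #|edges H|] sets
    [P]. *)
Lemma deg_embeddings_m2 (R : realType) (H : graph) (n : nat) (S : {set pair_of n}) :
  0 < m2 H -> (0 < n)%N -> S != set0 ->
  (deg (@embeddings H n) (@copy H n) S)%:R <=
  (2 ^ #|edges H| * #|edges H|.*2.+1 ^ #|vertex H|)%:R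
  * (n%:R `^ - (ratr (m2 H))^-1) ^+ #|S|.-1 * n%:R ^+ (#|vertex H| - 2) :> R.
Proof.
move=> m0 n0 S0; set m : R := ratr (m2 H); set p := n%:R `^ _.
have mR : 0 < m by rewrite ltr0q.
have n1 : (1 : R) <= n%:R by rewrite ler1n.
have nR : (0 : R) < n%:R by rewrite ltr0n.
have term (P : {set {set vertex H}}) : P \subset edges H -> #|P| = #|S| ->
    (n ^ (#|vertex H| - #|cover P|))%:R <= p ^+ #|S|.-1 * n%:R ^+ (#|vertex H| - 2).
  move=> PE PS; have P0 : P != set0 by rewrite -card_gt0 PS card_gt0.
  have c2 := card_cover_ge2 PE P0.
  have cv : (#|cover P| <= #|vertex H|)%N := max_card _.
  have -> : (#|vertex H| - 2 = #|cover P| - 2 + (#|vertex H| - #|cover P|))%N.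
    by rewrite addnC addnBA // subnK.
  rewrite exprD mulrA natrX ler_peMl ?exprn_ge0 ?ler0n //.
  rewrite -!powR_mulrn ?powR_ge0 ?ler0n // -powRrM -powRD; last first.
    by apply/implyP => _; rewrite gt_eqF.
  rewrite -[leLHS](powRr0 n%:R); apply: ler_powR => //.
  rewrite addrC mulNr subr_ge0 mulrC ler_pdivrMr // mulrC.
  have := card_edges_le_m2 PE P0; rewrite -(ler_rat R) PS rmorphM !rmorphB /=.
  rewrite !ratr_nat -/m.
  by rewrite -subn1 rmorph1 !natrB ?card_gt0.
rewrite -mulrA natrM -[leRHS]mulrA.
apply: (@le_trans _ _ (\sum_(P : {set {set vertex H}} |
    (P \subset edges H) && (#|P| == #|S|)) 
     (#|edges H|.*2.+1 ^ #|vertex H|)%:R * (p ^+ #|S|.-1 * n%:R ^+ (#|vertex H| - 2)))).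
  apply: le_trans (_ : _ <= (\sum_(P : {set {set vertex H}} |
    (P \subset edges H) && (#|P| == #|S|))
     (#|edges H|.*2.+1 ^ #|vertex H| * n ^ (#|vertex H| - #|cover P|)))%:R) _.
    by rewrite ler_nat deg_embeddings.
  rewrite natr_sum; apply: ler_sum => P /andP[PE /eqP PS].
  by rewrite natrM ler_wpM2l ?ler0n // term.
rewrite sumr_const -[leLHS]mulr_natl; apply: ler_wpM2r.
  by rewrite !mulr_ge0 ?ler0n ?exprn_ge0 ?powR_ge0.
rewrite ler_nat -card_powerset; apply: subset_leq_card; apply/subsetP => P.
by rewrite !inE => /andP[].
Qed.

(** * Client's win *)

Lemma ffact_ge_half n k : (k.*2 <= n)%N -> (n ^ k <= 2 ^ k * n ^_ k)%N.
Proof.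
elim: k => [|k IH] kn; first by rewrite ffactn0.
rewrite expnSr ffactnSr expnSr mulnACA leq_mul //.
  by apply: IH; apply: leq_trans kn; rewrite leq_double.
by lia.
Qed.

(** If Client's final graph had no copy of [H], some [D] in [C] would be disjoint from it, but the
    transversal strategy meets every [D]. The board consists of plain sets, so [C] is transported
    along [val]. *)
Lemma client_wins_of_containers (R : realFieldType) (H : graph) (n q : nat)
    (C : {set {set pair_of n}}) : (0 < q)%N ->
  (forall I : {set pair_of n},
     (forall j, j \in @embeddings H n -> ~~ (copy j \subset I)) ->
     exists2 D, D \in C & [disjoint D & I]) ->
  \sum_(D in C) (q%:R / (q%:R + 1) : R) ^+ #|D| < 1 ->
  client_wins_CW (complete_graph n) H q.
Proof.
move=> q0 CI small.
have [D' /imsetP[D DC ->{D'}]||s [sA swin]] := @client_hits_all R {set 'I_n} set0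
    (edges (complete_graph n)) q [set val @: (D : {set pair_of n}) | D in C] q0.
- by apply/subsetP => A /imsetP[x _ ->]; rewrite inE (valP x).
- rewrite big_imset /=; last by move=> D1 D2 _ _; apply: imset_inj; apply: val_inj.
  by under eq_bigr => D _ do rewrite (card_imset _ val_inj).
exists s; split=> // h hplay hend; have hits := swin h hplay hend.
set W := client_set h in hits *; pose I := [set x : pair_of n | val x \in W].
have [/exists_inP[j]|] := boolP [exists (j | j \in @embeddings H n), copy j \subset I].
  rewrite inE => /injectiveP jinj jI; exists j => // e eE.
  have je2 : #|j @: e| == 2 by rewrite card_imset // (card_edge eE).
  have := subsetP jI (exist (fun A : {set 'I_n} => #|A| == 2) _ je2).
  by rewrite !inE /=; apply; apply/imsetP; exists e.
rewrite negb_exists_in => /forall_inP /CI[D DC DI].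
have /negP[] := hits _ (imset_f (fun D : {set pair_of n} => val @: D) DC).
rewrite disjoint_subset; apply/subsetP => _ /imsetP[x xD ->].
have : x \notin I by rewrite (disjointFr DI).
by rewrite [x \in I]inE.
Qed.

(** Compare exponents: 'C(n, 2) + 1 is at most n^2, and q/(q+1) at most exp(-1/(q+1)). The 32
    collects the losses in b <= 2pn^2, q + 1 <= 2q and 'C(n, 2) >= n^2/4. *)
Lemma container_count_lt1 (R : realType) (n q b l k : nat) (p delta : R) :
  (2 <= n)%N -> (0 < q)%N -> 0 < delta ->
  b%:R <= 2 * p * n%:R ^+ 2 ->
  32 * l%:R * (p * q%:R * ln n%:R) < delta ->
  delta * ('C(n, 2))%:R <= k%:R ->
  ('C(n, 2).+1 ^ (l * b))%:R * (q%:R / (q%:R + 1)) ^+ k < 1 :> R.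
Proof.
move=> n2 q0 d0 bp small dk.
have n2R : (2 : R) <= n%:R by rewrite ler_nat.
have q1R : (1 : R) <= q%:R by rewrite ler1n.
have ln0 : 0 < ln n%:R :> R by rewrite ln_gt0 // ltr1n.
set N : R := ('C(n, 2))%:R in dk *.
have NE : N * 2 = n%:R * (n%:R - 1).
  by rewrite /N -natrM -[2%N]/(2`!) bin_ffact ffactnS ffactn1 natrM -subn1 natrB // ltnW.
have Nge : n%:R ^+ 2 / 4 <= N by nra.
have Nle : N + 1 <= n%:R ^+ 2 by nra.
have N0 : 0 < N by nra.
have r_le : q%:R / (q%:R + 1) <= expR (- (q%:R + 1)^-1) :> R.
  apply: le_trans (expR_ge1Dx _); rewrite le_eqVlt; apply/orP; left; apply/eqP.
  by field; rewrite gt_eqF //; lra.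
have rk : (q%:R / (q%:R + 1)) ^+ k <= expR (- (delta * N / (q%:R + 1))) :> R.
  apply: le_trans (lerXn2r _ _ _ r_le) _; rewrite ?nnegrE ?expR_ge0 ?divr_ge0 //; try lra.
  rewrite -expRM_natl ler_expR mulrN lerN2 ler_pM2r // invr_gt0; lra.
have Nb : ('C(n, 2).+1 ^ (l * b))%:R <= expR (2 * ln n%:R * (l%:R * b%:R)) :> R.
  rewrite natrX -natr1 -/N mulrC -natrM expRM_natl mulrC expRM_natr lnK ?posrE; last lra.
  by rewrite lerXn2r // ?nnegrE; lra.
apply: (@le_lt_trans _ _ (expR (2 * ln n%:R * (l%:R * b%:R)) *
  expR (- (delta * N / (q%:R + 1))))).
  by apply: ler_pM; rewrite // ?ler0n // exprn_ge0 // divr_ge0 //; lra.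
rewrite -expRD expR_lt1 subr_lt0 ltr_pdivlMr; last lra.
set B := b%:R; set Ln := ln n%:R in ln0 small *; set L := l%:R in small *.
have LL0 : 0 <= L * Ln by rewrite mulr_ge0 ?ler0n // ltW.
have p0 : 0 <= p * n%:R ^+ 2.
  by have : (0 : R) <= b%:R := ler0n _ _; rewrite -/B in bp *; lra.
have h1 : 2 * Ln * (L * B) * (q%:R + 1) <= 2 * (L * Ln) * (2 * p * n%:R ^+ 2) * (2 * q%:R).
  rewrite (_ : 2 * Ln * (L * B) = 2 * (L * Ln) * B); last by ring.
  apply: ler_pM; [|lra| |lra].
  - by rewrite mulr_ge0 ?ler0n // mulr_ge0.
  - by rewrite ler_wpM2l // mulr_ge0.
have h2 : 2 * (L * Ln) * (2 * p * n%:R ^+ 2) * (2 * q%:R)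
    = 32 * L * (p * q%:R * Ln) * (n%:R ^+ 2 / 4) by field.
apply: le_lt_trans h1 _; rewrite h2.
apply: (@lt_le_trans _ _ (delta * (n%:R ^+ 2 / 4))); last by rewrite ler_pM2l.
by rewrite ltr_pM2r //; nra.
Qed.

Theorem proposition1p6 (R : realType) (H : graph) (m2H_gt0 : 0 < m2 H) :
  exists2 c : R, 0 < c &
    forall n q : nat, (2 <= n)%N -> (1 <= q)%N ->
      q%:R <= c * (n%:R `^ (1 / ratr (m2 H)) / ln n%:R) ->
      client_wins_CW (complete_graph n) H q.
Proof.
set m : R := ratr (m2 H).
have m_half : 1 / 2 <= m.
  have := m2_ge_half m2H_gt0; rewrite -(ler_rat R) rmorphM fmorphV /= rmorph1 ratr_nat.
  by [].
have m0 : 0 < m by lra.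
set l := #|edges H|; set v := #|vertex H|.
have l0 : (0 < l)%N by apply: ltnW; apply: m2_gt0_card_edges.
have v2 : (2 <= v)%N.
  have /card_gt0P[e eE] := l0.
  by rewrite -(card_edge eE) max_card.
have c0 : (0 : R) < 2 ^- v by rewrite invr_gt0 exprn_gt0.
have K0 : (0 : R) < (2 ^ l * l.*2.+1 ^ v)%:R by rewrite ltr0n muln_gt0 !expn_gt0.
have [delta d0 cont] := containers l c0 K0.
clear K0.
have lR : (1 : R) <= l%:R by rewrite ler1n.
have ln2 : 0 < ln 2 :> R by rewrite ln_gt0 // ltr1n.
(* For n < 2v this constant pushes the bound on [q] down to 1/2, so only n >= 2v remains, as
   [ffact_ge_half] requires. *)
pose small_n : R := ln 2 / (2 * (v.*2)%:R `^ (1 / m)).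
have pow0 : (0 : R) < (v.*2)%:R `^ (1 / m).
  by rewrite powR_gt0 // ltr0n double_gt0 ltnW.
(* The 64 is twice the 32 of [container_count_lt1], which makes the inequality there strict. *)
exists (Num.min (delta / (64 * l%:R)) small_n).
  rewrite lt_min; apply/andP; split; apply: divr_gt0 => //; apply: mulr_gt0 => //; lra.
move=> n q n2 q1 qle.
have n2R : (2 : R) <= n%:R by rewrite ler_nat.
have nR : (0 : R) < n%:R by lra.
have qR : (1 : R) <= q%:R by rewrite ler1n.
have lnn : 0 < ln n%:R :> R by rewrite ln_gt0 //; lra.
have npow0 : 0 < n%:R `^ (1 / m) / ln n%:R by rewrite divr_gt0 // powR_gt0.
have q_delta : q%:R <= delta / (64 * l%:R) * (n%:R `^ (1 / m) / ln n%:R).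
  by apply: le_trans qle _; rewrite ler_pM2r // ge_min lexx.
have q_small : q%:R <= small_n * (n%:R `^ (1 / m) / ln n%:R).
  by apply: le_trans qle _; rewrite ler_pM2r // ge_min lexx orbT.
have nv : (v.*2 <= n)%N.
  rewrite leqNgt; apply/negP => nv.
  have powle : n%:R `^ (1 / m) <= (v.*2)%:R `^ (1 / m) :> R.
    rewrite ge0_ler_powR ?nnegrE ?ler0n ?ler_nat ?(ltnW nv) //.
    by rewrite divr_ge0 // ltW.
  have lnle : ln 2 <= ln n%:R :> R by rewrite ler_ln ?posrE.
  have : small_n * (n%:R `^ (1 / m) / ln n%:R) <= 1 / 2.
    rewrite mulrA ler_pdivrMr // /small_n mulrAC ler_pdivrMr ?mulr_gt0 //.
    rewrite (_ : 1 / 2 * ln n%:R * (2 * _) = ln n%:R * (v.*2)%:R `^ (1 / m)); last by field.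
    by rewrite ler_pM // ?ltW // powR_gt0.
  by move=> le; have := le_trans q_small le; lra.
pose p : R := n%:R `^ - m^-1.
have p0 : 0 < p by rewrite powR_gt0.
have p1 : p <= 1.
  by rewrite -[leRHS](powRr0 n%:R) ler_powR ?oppr_le0 ?invr_ge0 ?ltW //; lra.
have powD x y : n%:R `^ (x + y) = n%:R `^ x * n%:R `^ y :> R.
  by rewrite powRD //; apply/implyP => _; rewrite gt_eqF.
have pq : p * n%:R `^ (1 / m) = 1.
  by rewrite -powD div1r addNr powRr0.
(* This uses [m_half]; it absorbs the rounding in [b] below, giving [b <= 2 * p * n ^+ 2]. *)
have pn : 1 <= p * n%:R ^+ 2.
  rewrite -powR_mulrn ?ler0n // -powD.
  rewrite -[leLHS](powRr0 n%:R) ler_powR //; first by lra.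
  have : m^-1 <= 2 by rewrite invf_ple ?posrE //; lra.
  by lra.
have A0 : (0 : R) < n%:R ^+ (v - 2) by rewrite exprn_gt0.
have N1 : (0 < 'C(n, 2))%N by rewrite bin_gt0.
have Nn : ('C(n, 2))%:R <= n%:R ^+ 2 :> R.
  by rewrite -natrX ler_nat bin2 -divn2 -mulnn
     (leq_trans (leq_div _ _)) // leq_mul // leq_pred.
pose b := (Num.truncn (p * ('C(n, 2))%:R)).+1.
have pb : p * ('C(n, 2))%:R <= b%:R by apply/ltW/truncnS_gt.
have bp : b%:R <= 2 * p * n%:R ^+ 2.
  have h : p * ('C(n, 2))%:R <= p * n%:R ^+ 2 by rewrite ler_pM2l.
  have : (Num.truncn (p * ('C(n, 2))%:R))%:R <= p * ('C(n, 2))%:R.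
    by rewrite truncn_le mulr_ge0 // ltW.
  by rewrite /b -natr1; lra.
have [|||j jX|S S0|C [Cb CD CI]] :=
    cont _ _ (@copy H n) (@embeddings H n) p (n%:R ^+ (v - 2)) b p0 p1 A0.
- by rewrite card_pair_of.
- by rewrite card_pair_of.
- rewrite card_pair_of card_embeddings -/v mulrAC.
  apply: (@le_trans _ _ (2 ^- v * n%:R ^+ v)).
    rewrite -mulrA ler_pM2l // -[v in leRHS](subnKC v2) exprD.
    by rewrite ler_pM2r.
  rewrite mulrC ler_pdivrMr ?exprn_gt0 // -!natrX -natrM ler_nat mulnC.
  exact: ffact_ge_half.
- exact: card_copy.
- by apply: deg_embeddings_m2 => //; apply: ltnW.
apply: (client_wins_of_containers (R := R) (C := C)) => //.
rewrite card_pair_of in Cb CD.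
(* Every term of the sum is at most that of a smallest member [D1], so the sum is at most [#|C|]
   times it. *)
have [->|[D0 D0C]] := set_0Vmem C; first by rewrite big_set0.
case: (arg_minnP (fun D : {set pair_of n} => #|D|) D0C) => D1 D1C minD1.
have r0 : 0 <= q%:R / (q%:R + 1) :> R by apply: divr_ge0; lra.
have r1 : q%:R / (q%:R + 1) <= 1 :> R by rewrite ler_pdivrMr; lra.
have small : 32 * l%:R * (p * q%:R * ln n%:R) < delta.
  have : p * q%:R * ln n%:R <= delta / (64 * l%:R).
    rewrite mulrAC -(_ : p * ln n%:R *
        (delta / (64 * l%:R) * (n%:R `^ (1 / m) / ln n%:R)) = delta / (64 * l%:R)).
      by rewrite ler_pM2l // mulr_gt0.
    rewrite [LHS](_ : _ = p * n%:R `^ (1 / m) * (delta / (64 * l%:R))).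
      by rewrite pq mul1r.
    by field; rewrite !gt_eqF //; lra.
  rewrite -(ler_pM2l (_ : 0 < 32 * l%:R)); last by lra.
  move=> le; apply: le_lt_trans le _.
  rewrite (_ : 32 * l%:R * (delta / (64 * l%:R)) = delta / 2);
    last by field; rewrite gt_eqF //; lra.
  by lra.
apply: le_lt_trans (container_count_lt1 n2 q1 d0 bp small (CD D1 D1C)).
apply: (@le_trans _ _ (\sum_(D in C) (q%:R / (q%:R + 1)) ^+ #|D1|)).
  by apply: ler_sum => D /minD1 leD; rewrite ler_wiXn2l.
rewrite sumr_const -[leLHS]mulr_natl; apply: ler_wpM2r; first by rewrite exprn_ge0.
by rewrite ler_nat.
Qed.
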